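(* Let $H$ be a real Hilbert space and let $W\subset H$ be nonempty, closed, and convex, with diameter $D<\infty$. Fix $1<p\le 2$, let $(\mathcal{F}_t)_{t\ge 0}$ be a filtration on a probability space $\Omega$, and let $(g_t)_{t\ge 1}$ be adapted to it with $g_t\in L^p(\Omega;H)$ for every $t$. For (deterministic) $\eta,\tau>0$, put $$Y_t=C_\tau(g_t),\qquad M_t=\mathbb{E}\bigl[\lVert g_t\rVert^p\mid\mathcal{F}_{t-1}\bigr]<\infty,$$ and define $w_t$ as the unique minimizer $$w_t\in\mathop{\arg\min}_{w\in W}\left\{\sum_{s<t}\langle Y_s,w\rangle+\frac{\lVert w\rVert^2}{2\eta}\right\},$$ where the sum runs over $1\le s<t$. For $T\ge 1$ and (deterministic) $u\in W$, let $$R_T(u)=\sum_{t=1}^T\langle g_t,w_t-u\rangle .$$ Then $$\mathbb{E}R_T(u)\le\frac{\lVert u\rVert^2}{2\eta}+\sum_{t=1}^T\mathbb{E}\left[K_p\!\left(D,\frac{\eta\tau}{2}\right)\tau^{1-p}M_t\right].$$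
   Context: $L^p(\Omega;H)$ denotes the Bochner space; $\langle\cdot,\cdot\rangle$ is the inner product of $H$. For $\tau>0$, radial clipping is the map $C_\tau:H\to H$ with $C_\tau(x)=x$ if $\lVert x\rVert\le\tau$ and $C_\tau(x)=\tau x/\lVert x\rVert$ if $\lVert x\rVert>\tau$. For $1<p\le 2$ put $c_p=\dfrac{(p-1)^{p-1}}{p^p}$. For $\alpha,\beta\ge 0$ define $$K_p(\alpha,\beta)=\begin{cases}\beta,&\alpha\le p\beta,\\ c_p\,\dfrac{\alpha^p}{(\alpha-\beta)^{p-1}},&\alpha>p\beta.\end{cases}$$ *)

(* Defs.v *)
From HB Require Import structures.
From mathcomp Require Import all_boot all_order all_algebra.
From mathcomp Require Import sesquilinear.
From mathcomp Require Import all_classical all_reals all_analysis.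

Set Implicit Arguments.
Unset Strict Implicit.
Unset Printing Implicit Defensive.

Import Order.TTheory GRing.Theory Num.Theory.
Import numFieldNormedType.Exports.

Local Open Scope classical_set_scope.
Local Open Scope ring_scope.

Definition diameter (R : realType) (H : normedModType R) (A : set H) : \bar R :=
  ereal_sup [set (`|x.1 - x.2|)%:E | x in A `*` A].

Definition clip (R : realType) (H : normedModType R) (tau : R) (x : H) : H :=
  if `|x| <= tau then x else (tau / `|x|) *: x.

Definition c_ (R : realType) (p : R) : R :=
  (p - 1) `^ (p - 1) / p `^ p.

Definition K_ (R : realType) (p alpha beta : R) : R :=
  if alpha <= p * beta then beta
  else c_ p * (alpha `^ p / (alpha - beta) `^ (p - 1)).

Definition argmin (R : realType) (H : Type) (W : set H) (f : H -> R) : set H :=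
  [set w | W w /\ forall v, W v -> f w <= f v].

(* On a nonempty closed convex subset of a Hilbert space the objective is
   continuous and strongly convex, so for eta > 0 the argmin set is a singleton
   and the default value 0 of xget is not used. *)
Definition ftrl (R : realType) (H : normedModType R) (dot : H -> H -> R)
    (W : set H) (eta : R) (Y : nat -> H) (t : nat) : H :=
  xget 0 (argmin W
    (fun w => \sum_(1 <= s < t) dot (Y s) w + `|w| ^+ 2 / (2 * eta))).

Section probability.
Context (d : measure_display) (Omega : measurableType d) (R : realType).

Definition filtration (F : nat -> set (set Omega)) : Prop :=
  [/\ forall t, sigma_algebra setT (F t),
      forall t, F t `<=` measurable &
      forall s t, (s <= t)%N -> F s `<=` F t].

(* H may be non-separable, so measurability of H-valued maps is strong
   measurability: f is a pointwise limit of G-simple functions. *)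
Definition strongly_measurable (H : normedModType R) (G : set (set Omega))
    (f : Omega -> H) : Prop :=
  exists s : nat -> Omega -> H,
    (forall n, finite_set (range (s n)) /\ forall x, G (s n @^-1` [set x])) /\
    (forall omega, s n omega @[n --> \oo] --> f omega).

(* f represents a class of the Bochner space L^p(Omega; H). *)
Definition bochner_Lp (P : probability Omega R) (H : normedModType R) (p : R)
    (f : Omega -> H) : Prop :=
  strongly_measurable measurable f /\
  (\int[P]_omega (`|f omega| `^ p)%:E < +oo)%E.

(* M is a version of the conditional expectation of X given G. *)
Definition is_cond_expectation (P : probability Omega R) (G : set (set Omega))
    (X M : Omega -> R) : Prop :=
  [/\ measurable_fun [set: g_sigma_algebraType G] (M : g_sigma_algebraType G -> R),
      P.-integrable setT (EFin \o M) &
      forall A, G A ->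
        (\int[P]_(omega in A) (M omega)%:E = \int[P]_(omega in A) (X omega)%:E)%E].

End probability.

(* Main.v *)
Require Import Defs.
From HB Require Import structures.
From mathcomp Require Import all_boot all_order all_algebra.
From mathcomp Require Import sesquilinear.
From mathcomp Require Import all_classical all_reals all_analysis.
From mathcomp Require Import measurable_realfun.
From mathcomp Require Import ring lra.

Set Implicit Arguments.
Unset Strict Implicit.
Unset Printing Implicit Defensive.

Import Order.TTheory GRing.Theory Num.Theory.
Import numFieldNormedType.Exports.

Local Open Scope classical_set_scope.
Local Open Scope ring_scope.

(** The inequality holds pathwise: along every trajectory
    R_T(u) <= |u|^2 / (2 eta) + kappa * sum_t |g_t|^p
    with kappa = K_p(D, eta tau / 2) tau^(1 - p), and conditioning enters only
    through E M_t = E |g_t|^p.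

    Write Y_t for the clipped gradient and split
    <g_t, w_t - u> = <Y_t, w_t - u> + <g_t - Y_t, w_t - u>.
    The first part is the regret of follow-the-regularized-leader on the
    bounded sequence Y.  Its objective grows at least like
    |v - w_t|^2 / (2 eta) around the minimizer w_t ([argmin_growth]), so the
    minimal values telescope and the regret is at most
    |u|^2 / (2 eta) + sum_t (eta / 2) |Y_t|^2 ([ftrl_regret]).  The second part
    is at most D |g_t - Y_t| by Cauchy-Schwarz.

    A round thus costs (eta / 2) |Y_t|^2 + D |g_t - Y_t|.  With |g_t| = tau y
    and beta = eta tau / 2 this equals tau (beta min(y, 1)^2 + D max(y - 1, 0)),
    and K_p(D, beta) is exactly the supremum over y > 0 of
    (beta min(y, 1)^2 + D max(y - 1, 0)) / y^p.  For y <= 1 the comparison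
    uses y^2 <= y^p; for y >= 1 it says that an affine function lies below a
    multiple of y^p, which is a tangent-line inequality ([K_tail],
    [clip_cost]).

    That w_t is a minimizer at all rests on the projection theorem
    ([projection_exists]): completing the square, the objective is up to a
    constant the squared distance to - eta * sum_(s < t) Y_s. *)

(** * The scalar inequality behind K_p *)

Section scalar.
Context (R : realType).
Implicit Types p y z alpha beta : R.

Lemma powRV (x r : R) : 0 <= x -> (x^-1) `^ r = (x `^ r)^-1.
Proof. by move=> x0; rewrite -powR_inv1// -powRrM mulN1r powRN. Qed.

(** Young's inequality for the product of z and 1, with exponent p on z. *)
Lemma powR_ge_tangent p z : 1 < p -> 0 <= z -> 1 + p * (z - 1) <= z `^ p.
Proof.
move=> p1 z0; have p0 : 0 < p by lra.
have q0 : 0 < p / (p - 1) by apply: divr_gt0; lra.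
have pq : p^-1 + (p / (p - 1))^-1 = 1 by field; apply/andP; split; apply/eqP; lra.
have := conjugate_powR z0 ler01 p0 q0 pq.
rewrite mulr1 powR1 mul1r -(@ler_pM2l _ p) // mulrDr.
have -> : p * (z `^ p / p) = z `^ p by field; apply/eqP; lra.
have -> : p * (p / (p - 1))^-1 = p - 1 by field; apply/andP; split; apply/eqP; lra.
lra.
Qed.

(** Both branches are tangent-line bounds for y^p.  If alpha <= p beta, the ratio
    (beta + alpha (y - 1)) / y^p is maximal over y >= 1 at y = 1, and the
    tangent is taken there.  Otherwise the ratio is maximal at
    p (alpha - beta) / ((p - 1) alpha) > 1, where the tangent is taken and where
    the ratio equals the second branch of K_p. *)
Lemma K_tail p alpha beta y : 1 < p -> 0 <= beta -> 1 <= y ->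
  beta + alpha * (y - 1) <= K_ p alpha beta * y `^ p.
Proof.
move=> p1 b0 y1; have y0 : 0 <= y := le_trans ler01 y1.
rewrite /K_; case: ifPn => [ab|].
  have := powR_ge_tangent p1 y0; move/(ler_wpM2l b0); nra.
rewrite -ltNge => ab.
have ab1 : 0 < alpha - beta by nra.
have a0 : 0 < alpha by lra.
have p0 : 0 < p - 1 by lra.
pose ymax := p * (alpha - beta) / ((p - 1) * alpha).
have ymax0 : 0 < ymax by rewrite /ymax divr_gt0// mulr_gt0//; lra.
(* The value at the point of tangency: the first-order condition makes the
   maximal ratio times ymax^p equal to alpha * ymax / p. *)
have Ky : c_ p * (alpha `^ p / (alpha - beta) `^ (p - 1)) * ymax `^ p
    = alpha * ymax / p.
  rewrite /c_ -(mulr_powRB1 (ltW ymax0)) // /ymax; last lra.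
  rewrite -[X in _ * (X / _)](mulr_powRB1 (ltW a0)); last lra.
  rewrite -(mulr_powRB1 (x := p) (p := p)); [|lra|lra].
  rewrite powRM; [|by apply: mulr_ge0; lra|by rewrite invr_ge0 mulr_ge0//; lra].
  rewrite powRM; [|lra|lra].
  rewrite powRV ?mulr_ge0 ?(ltW p0) ?(ltW a0)// powRM ?(ltW p0) ?(ltW a0)//.
  have h (x : R) : 0 < x -> x `^ (p - 1) != 0 by move=> x0; rewrite gt_eqF ?powR_gt0.
  field.
  rewrite !h ?gt_eqF ?powR_gt0//=; lra.
have z0 : 0 <= y / ymax by rewrite divr_ge0// ltW.
have := powR_ge_tangent p1 z0.
have K0 : 0 <= alpha * ymax / p by apply: divr_ge0; [apply: mulr_ge0; exact: ltW|lra].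
move/(ler_wpM2l K0).
rewrite -[in X in _ <= X]Ky -[leRHS]mulrA -powRM; [|exact: ltW|exact: z0].
rewrite (_ : ymax * (y / ymax) = y); last by field; rewrite gt_eqF.
apply: le_trans.
have e : alpha * ymax * (p - 1) = p * (alpha - beta).
  by rewrite /ymax; field; repeat (apply/andP; split); apply/eqP; lra.
have -> : alpha * ymax / p * (1 + p * (y / ymax - 1)) =
    alpha * y - alpha * ymax * (p - 1) / p.
  by field; repeat (apply/andP; split); apply/eqP; lra.
rewrite e (_ : p * (alpha - beta) / p = alpha - beta); first by lra.
by field; rewrite gt_eqF//; lra.
Qed.

Lemma K_ge p alpha beta : 1 < p -> 0 <= beta -> beta <= K_ p alpha beta.
Proof.
move=> p1 b0; have := K_tail alpha p1 b0 (lexx 1).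
by rewrite powR1 subrr mulr0 addr0 mulr1.
Qed.

End scalar.

(** * Inner products and projection onto a closed convex set *)

Section hilbert.
Context (R : realType) (H : completeNormedModType R) (dot : {dot H for idfun}).
Context (dotE : forall x : H, dot x x = `|x| ^+ 2).
Implicit Types (x y z v w : H) (a k : R).

Lemma dotC x y : dot x y = dot y x.
Proof. by rewrite hermC expr0 mul1r. Qed.

Lemma dotZl a x y : dot (a *: x) y = a * dot x y.
Proof. exact: linearZl_LR. Qed.

Lemma dotZr a x y : dot x (a *: y) = a * dot x y.
Proof. exact: linearZr_LR. Qed.

Lemma sqnormD x y : `|x + y| ^+ 2 = `|x| ^+ 2 + 2 * dot x y + `|y| ^+ 2.
Proof. rewrite -!dotE linearDl !linearDr /= (dotC y x); ring. Qed.

Lemma sqnormB x y : `|x - y| ^+ 2 = `|x| ^+ 2 - 2 * dot x y + `|y| ^+ 2.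
Proof. rewrite sqnormD linearNr normrN /=; ring. Qed.

(** Cauchy-Schwarz, from the square of |y| x - |x| y. *)
Lemma dot_le_norm x y : dot x y <= `|x| * `|y|.
Proof.
have [->|x0] := eqVneq x 0; first by rewrite linear0l normr0 mul0r.
have [->|y0] := eqVneq y 0; first by rewrite linear0r normr0 mulr0.
have xy0 : 0 < `|x| * `|y| by rewrite mulr_gt0 ?normr_gt0.
have := sqr_ge0 `|(`|y| *: x - `|x| *: y)|.
rewrite sqnormB !normrZ !normr_id dotZl dotZr => h.
rewrite -(ler_pM2l xy0); nra.
Qed.

Lemma sqnorm_combination k x y :
  `|k *: x + (1 - k) *: y| ^+ 2 =
  k * `|x| ^+ 2 + (1 - k) * `|y| ^+ 2 - k * (1 - k) * `|x - y| ^+ 2.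
Proof. rewrite sqnormB sqnormD -!dotE !dotZl !dotZr; ring. Qed.

(** Stewart's identity: it measures the strong convexity of the squared distance
    to z, and for k = 1/2 it is the parallelogram law. *)
Lemma sqnorm_combinationB k x y z :
  `|k *: x + (1 - k) *: y - z| ^+ 2 =
  k * `|x - z| ^+ 2 + (1 - k) * `|y - z| ^+ 2 - k * (1 - k) * `|x - y| ^+ 2.
Proof.
have -> : k *: x + (1 - k) *: y - z = k *: (x - z) + (1 - k) *: (y - z).
  rewrite !scalerBr addrACA -opprD -scalerDl.
  by rewrite (_ : k + (1 - k) = 1) ?scale1r//; ring.
rewrite sqnorm_combination; congr (_ - _ * `|_| ^+ 2).
by rewrite opprB addrA subrK.
Qed.

Section projection.
Context (W : set H) (W0 : W !=set0) (Wclosed : closed W).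
Context (Wconvex : convex_set (W : set (convex_lmodType H))).

Lemma convex_combination k x y : 0 <= k <= 1 -> W x -> W y ->
  W (k *: x + (1 - k) *: y).
Proof.
move=> /andP[k0 k1] Wx Wy.
have k01 : Itv.spec (@Itv.num_sem R) (Itv.Real `[0, 1]%Z) k.
  by apply/andP; split; [exact: ger0_real|rewrite in_itv/= k0 k1].
have := @Wconvex x y (Itv.mk k01).
by rewrite !inE; exact.
Qed.

(** The near-minimizers of the distance to x form a filter base on W; by the
    parallelogram law their diameters shrink to 0, so completeness supplies a
    limit, which attains the infimum by continuity. *)
Lemma projection_exists x :
  exists2 w, W w & forall v, W v -> `|w - x| <= `|v - x|.
Proof.
pose E := [set `|v - x| ^+ 2 | v in W].
have lbE : has_lbound E by exists 0 => _ [v _ <-]; exact: sqr_ge0.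
have infE : has_inf E by split=> //; case: W0 => v Wv; exists (`|v - x| ^+ 2), v.
pose B (e : R) := [set v | W v /\ `|v - x| ^+ 2 < inf E + e].
pose F := filter_from [set e : R | 0 < e] B.
have FF : ProperFilter F.
  apply: filter_from_proper => [|e /= e0].
    apply: filter_from_filter => [|e f /= e0 f0]; first by exists 1 => /=.
    exists (Num.min e f) => /=; first by rewrite lt_min e0 f0.
    move=> v [Wv vm]; split; split=> //; apply: (lt_le_trans vm);
    by rewrite lerD2l ge_min lexx ?orbT.
  by have [_ [v Wv <-] vm] := inf_adherent e0 infE; exists v.
have B_diam e u v : B e u -> B e v -> `|u - v| ^+ 2 < 4 * e.
  move=> [Wu ue] [Wv ve].
  have half : 0 <= (2^-1 : R) <= 1 by apply/andP; split; lra.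
  have := ge_inf lbE (imageP (fun v => `|v - x| ^+ 2) (convex_combination half Wu Wv)).
  rewrite sqnorm_combinationB; nra.
have FB e : 0 < e -> F (B e) by exists e.
have Fcvg : cvg F.
  apply: cauchy_cvg; apply/cauchyP => e e0.
  have f0 : 0 < e ^+ 2 / 4 by rewrite divr_gt0// exprn_gt0.
  have [u Bu] := filter_ex (FB _ f0).
  exists u; apply: filterS (FB _ f0) => v Bv.
  rewrite -ball_normE /= -(@ltr_pXn2r _ 2) ?nnegrE ?(ltW e0)//.
  by have := B_diam _ _ _ Bu Bv; lra.
have FW : \forall v \near F, W v by apply: filterS (FB _ ltr01) => v [].
have WlimF : W (lim F) by exact: (closed_cvg W Wclosed FW _ Fcvg).
have cont : `|v - x| ^+ 2 @[v --> F] --> `|lim F - x| ^+ 2.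
  rewrite !expr2; under eq_fun do rewrite expr2.
  by apply: cvgM; apply: cvg_norm; apply: cvgB => //; exact: cvg_cst.
exists (lim F) => [|v Wv]; first exact: WlimF.
rewrite -(@ler_pXn2r _ 2) ?nnegrE//.
apply: le_trans (ge_inf lbE (imageP (fun v => `|v - x| ^+ 2) Wv)).
apply/ler_addgt0Pr => e e0.
apply: (closed_cvg (fun r => r <= inf E + e) (@closed_le _ _) _ _ cont).
by apply: filterS (FB _ e0) => u [_ /ltW].
Qed.

(** Comparing w with the point k v + (1 - k) w of W, for small k, gives the claim
    with (1 - k) |v - w|^2 in place of |v - w|^2; then k tends to 0. *)
Lemma projection_pythagoras x w v : W w ->
    (forall u, W u -> `|w - x| <= `|u - x|) -> W v ->
  `|v - w| ^+ 2 + `|w - x| ^+ 2 <= `|v - x| ^+ 2.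
Proof.
move=> Ww minw Wv; apply/ler_addgt0Pr => e e0.
pose b := `|v - w| ^+ 2.
have b0 : 0 <= b := sqr_ge0 _.
(* This k makes k * b at most the slack e. *)
pose k := e / (b + e).
have k0 : 0 < k by rewrite divr_gt0//; lra.
have ke : k * (b + e) = e by rewrite /k divfK// gt_eqF//; lra.
have k1 : k <= 1 by rewrite /k ler_pdivrMr; lra.
have k01 : 0 <= k <= 1 by rewrite (ltW k0).
have := minw _ (convex_combination k01 Wv Ww).
rewrite -(@ler_pXn2r _ 2) ?nnegrE// sqnorm_combinationB -/b.
move: (`|w - x| ^+ 2) (`|v - x| ^+ 2) => c a h.
have : k * c <= k * (a - (1 - k) * b) by nra.
rewrite ler_pM2l//; nra.
Qed.

(** * Regret of follow-the-regularized-leader *)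

Section ftrl.
Context (eta : R) (eta0 : 0 < eta).

Let obj (theta v : H) := dot theta v + `|v| ^+ 2 / (2 * eta).

Lemma complete_square theta v :
  obj theta v =
  (`|v - - eta *: theta| ^+ 2 - eta ^+ 2 * `|theta| ^+ 2) / (2 * eta).
Proof.
rewrite /obj sqnormB dotZr normrZ normrN gtr0_norm// (dotC v).
by field; rewrite gt_eqF.
Qed.

Lemma argmin_nonempty theta : argmin W (obj theta) !=set0.
Proof.
have [w Ww minw] := projection_exists (- eta *: theta).
exists w; split=> // v Wv; rewrite !complete_square.
rewrite ler_pM2r ?invr_gt0 ?mulr_gt0// lerD2r ler_pXn2r ?nnegrE//.
exact: minw.
Qed.

(** The objective is (2 eta)^-1 times a squared distance, up to a constant, so
    its strong convexity at the minimizer is the Pythagorean inequality for the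
    projection. *)
Lemma argmin_growth theta w v : argmin W (obj theta) w -> W v ->
  obj theta w + `|v - w| ^+ 2 / (2 * eta) <= obj theta v.
Proof.
move=> [Ww minw] Wv; have eta2 : 0 < (2 * eta)^-1 by rewrite invr_gt0 mulr_gt0.
have minw' u : W u -> `|w - - eta *: theta| <= `|u - - eta *: theta|.
  move=> Wu; have := minw u Wu; rewrite !complete_square.
  by rewrite ler_pM2r// lerD2r ler_pXn2r ?nnegrE.
have := projection_pythagoras Ww minw' Wv.
rewrite !complete_square -mulrDl ler_pM2r//; lra.
Qed.

Lemma ftrl_argmin (Y : nat -> H) t :
  argmin W (obj (\sum_(1 <= s < t) Y s)) (ftrl dot W eta Y t).
Proof.
rewrite /ftrl; set f := (X in xget _ (argmin W X)).
have <- : obj (\sum_(1 <= s < t) Y s) = f.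
  by apply/funext => v; rewrite /obj linear_sumlz.
exact: xgetPex (argmin_nonempty _).
Qed.

(** Telescope the minimal values of the objective.  When round t is added, a
    displacement delta of the minimizer costs |delta|^2 / (2 eta) by
    [argmin_growth] and gains - dot (Y t) delta, which exceeds that cost by at
    most eta / 2 * |Y t|^2.  So the minimal value increases by at least
    dot (Y t) (w t) - eta / 2 * |Y t|^2, and the last one is at most the
    objective at u. *)
Lemma ftrl_regret (Y : nat -> H) (T : nat) (u : H) : W u ->
  \sum_(1 <= t < T.+1) dot (Y t) (ftrl dot W eta Y t - u) <=
  `|u| ^+ 2 / (2 * eta) + \sum_(1 <= t < T.+1) eta / 2 * `|Y t| ^+ 2.
Proof.
move=> Wu; pose w := ftrl dot W eta Y; pose theta t := \sum_(1 <= s < t) Y s.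
have value_growth n :
    \sum_(1 <= t < n.+1) (dot (Y t) (w t) - eta / 2 * `|Y t| ^+ 2) <=
    obj (theta n.+1) (w n.+1).
  elim: n => [|n IH].
    rewrite /obj /theta !big_geq// linear0l add0r.
    by rewrite divr_ge0 ?mulr_ge0 ?sqr_ge0// ltW.
  rewrite big_nat_recr//=.
  have [Ww' _] := ftrl_argmin Y n.+2.
  have grow := argmin_growth (ftrl_argmin Y n.+1) Ww'.
  have young : dot (Y n.+1) (w n.+1) - eta / 2 * `|Y n.+1| ^+ 2 <=
      `|w n.+2 - w n.+1| ^+ 2 / (2 * eta) + dot (Y n.+1) (w n.+2).
    have := sqr_ge0 `|w n.+2 - w n.+1 + eta *: Y n.+1|.
    rewrite sqnormD dotZr normrZ gtr0_norm// (dotC _ (Y n.+1)) linearBr.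
    have eta2 : 0 < (2 * eta)^-1 by rewrite invr_gt0 mulr_gt0.
    move=> /(mulr_ge0 (ltW eta2)).
    rewrite [X in 0 <= X -> _](_ : _ = `|w n.+2 - w n.+1| ^+ 2 / (2 * eta)
      + (dot (Y n.+1) (w n.+2) - dot (Y n.+1) (w n.+1))
      + eta / 2 * `|Y n.+1| ^+ 2); first by lra.
    by field; rewrite gt_eqF.
  have -> : obj (theta n.+2) (w n.+2) =
      obj (theta n.+1) (w n.+2) + dot (Y n.+1) (w n.+2).
    by rewrite /obj /theta (big_nat_recr n.+1)//= linearDl addrAC.
  rewrite -/(theta n.+1) -/(w n.+1) -/(w n.+2) in grow; lra.
have [_ /(_ u Wu) minT] := ftrl_argmin Y T.+1.
have := le_trans (value_growth T) minT.
rewrite /obj linear_sumlz sumrB.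
under [in X in _ -> X]eq_bigr do rewrite linearBr.
rewrite sumrB /w; lra.
Qed.

End ftrl.

End projection.

End hilbert.

(** * The cost of one round *)

(** By homogeneity everything is tau times a function of y = |x| / tau.  A short
    vector is not clipped and pays the quadratic term, where y^2 <= y^p; a long
    one pays the constant beta and the bias D (y - 1), which is [K_tail]. *)
Lemma clip_cost (R : realType) (H : normedModType R) (p eta tau D : R) (x : H) :
    1 < p -> p <= 2 -> 0 < eta -> 0 < tau ->
  eta / 2 * `|clip tau x| ^+ 2 + D * `|x - clip tau x| <=
  K_ p D (eta * tau / 2) * tau `^ (1 - p) * `|x| `^ p.
Proof.
move=> p1 p2 eta0 tau0; set beta := eta * tau / 2.
have beta0 : 0 <= beta by rewrite /beta divr_ge0 ?mulr_ge0 ?ltW.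
pose y := `|x| / tau.
have y0 : 0 <= y by rewrite divr_ge0// ltW.
have xE : `|x| = tau * y by rewrite /y mulrC divfK// gt_eqF.
have -> : K_ p D beta * tau `^ (1 - p) * `|x| `^ p = tau * (K_ p D beta * y `^ p).
  rewrite xE powRM ?(ltW tau0)// (_ : _ * _ * _ =
    (tau `^ (1 - p) * tau `^ p) * (K_ p D beta * y `^ p)); last by ring.
  by rewrite -powRD ?subrK ?powRr1 ?(ltW tau0)// oner_eq0.
rewrite /clip; case: ifPn => xtau.
  have y1 : y <= 1 by rewrite /y ler_pdivrMr// mul1r.
  rewrite subrr normr0 mulr0 addr0 xE.
  rewrite (_ : _ * _ = tau * (beta * y ^+ 2)); last by rewrite /beta; ring.
  rewrite ler_pM2l//; apply: ler_pM => //; [exact: sqr_ge0|exact: K_ge|].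
  have [->|yn0] := eqVneq y 0; first by rewrite expr0n/= powR_ge0.
  by rewrite -powR_mulrn// ger_powR// lt_neqAle eq_sym yn0 y0.
rewrite -ltNge in xtau.
have x0 : 0 < `|x| := lt_trans tau0 xtau.
have y1 : 1 <= y by rewrite /y ler_pdivlMr// mul1r ltW.
have -> : `|(tau / `|x|) *: x| = tau.
  by rewrite normrZ ger0_norm ?divr_ge0 ?(ltW tau0)// divfK// gt_eqF.
have -> : `|x - (tau / `|x|) *: x| = tau * (y - 1).
  rewrite -[X in X - _]scale1r -scalerBl normrZ ger0_norm.
    by rewrite mulrBl mul1r divfK ?gt_eqF// xE; ring.
  by rewrite subr_ge0 ler_pdivrMr// mul1r ltW.
rewrite (_ : _ + _ = tau * (beta + D * (y - 1))); last by rewrite /beta; ring.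
by rewrite ler_pM2l// K_tail.
Qed.

Lemma le_diameter (R : realType) (H : normedModType R) (W : set H) (D : R) x y :
  diameter W = D%:E -> W x -> W y -> `|x - y| <= D.
Proof.
by move=> WD Wx Wy; rewrite -lee_fin -WD; apply: ereal_sup_ubound; exists (x, y).
Qed.

(** The pathwise bound: each inner product with g_t is split into its clipped part,
    left to [ftrl_regret], and the clipping bias. *)
Lemma clipped_ftrl_regret (R : realType) (H : completeNormedModType R)
    (dot : {dot H for idfun}) (W : set H) (D p eta tau : R)
    (g : nat -> H) (T : nat) (u : H) :
  (forall x, dot x x = `|x| ^+ 2) ->
  W !=set0 -> closed W -> convex_set (W : set (convex_lmodType H)) ->
  diameter W = D%:E -> 1 < p -> p <= 2 -> 0 < eta -> 0 < tau -> W u ->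
  \sum_(1 <= t < T.+1)
    dot (g t) (ftrl dot W eta (fun s => clip tau (g s)) t - u) <=
  `|u| ^+ 2 / (2 * eta) +
  \sum_(1 <= t < T.+1) K_ p D (eta * tau / 2) * tau `^ (1 - p) * `|g t| `^ p.
Proof.
move=> dotE W0 Wcl Wcv WD p1 p2 eta0 tau0 Wu.
set Y := fun s => clip tau (g s); set w := ftrl dot W eta Y.
have Ww t : W (w t) by have [] := ftrl_argmin dotE W0 Wcl Wcv eta0 Y t.
have round t : dot (g t) (w t - u) <= dot (Y t) (w t - u) + D * `|g t - Y t|.
  rewrite -[X in dot X _](subrK (Y t)) linearDl addrC lerD2l.
  apply: le_trans (dot_le_norm dotE _ _) _.
  by rewrite mulrC ler_wpM2r// (le_diameter WD).
apply: le_trans (ler_sum _ (fun t _ => round t)) _.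
rewrite big_split/=.
apply: le_trans (lerD (ftrl_regret dotE W0 Wcl Wcv eta0 Y T Wu) (lexx _)) _.
rewrite -addrA lerD2l -big_split/=; apply: ler_sum => t _.
exact: clip_cost.
Qed.

(** * Integrals *)

Section integral.
Context d (T : measurableType d) (R : realType).

Import HBNNSimple.

(** The integral of a nonnegative function is a supremum over the simple functions
    below it, hence monotone whether or not the function is measurable; the
    positive and negative parts then give the general case.  This spares a proof
    that the minimizers, hence the regret, are measurable in omega. *)
Lemma le_integral_nonmeasurable (mu : {measure set T -> \bar R}) (f g : T -> \bar R) :
  (forall x, (f x <= g x)%E) -> (\int[mu]_x f x <= \int[mu]_x g x)%E.
Proof.
move=> fg; rewrite /integral !patch_setT.
have le_sup (a b : T -> \bar R) : (forall x, (a x <= b x)%E) ->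
    (ereal_sup [set sintegral mu h |
       h in [set h : {nnsfun T >-> R} | forall x, ((h x)%:E <= a x)%E]] <=
     ereal_sup [set sintegral mu h |
       h in [set h : {nnsfun T >-> R} | forall x, ((h x)%:E <= b x)%E]])%E.
  move=> ab; apply: ereal_sup_le; apply: image_subset => h ha x.
  exact: le_trans (ha x) (ab x).
have inT x : x \in [set: T] by rewrite inE.
by apply: leeB; apply: le_sup => x;
  [exact: (funepos_le (fun x _ => fg x))|exact: (funeneg_le (fun x _ => fg x))].
Qed.

(** The norm of a simple function is measurable because its range is finite;
    then pass to the pointwise limit. *)
Lemma strongly_measurable_norm (H : normedModType R) (f : T -> H) :
  strongly_measurable measurable f ->
  measurable_fun setT (fun x => `|f x|).
Proof.
move=> [s [simple_s cvg_s]].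
apply: (@measurable_fun_cvg _ _ _ _ (fun n x => `|s n x|)) => [n|x _].
  have [fin_s meas_s] := simple_s n.
  move=> _ B _; rewrite setTI.
  have -> : (fun x => `|s n x|) @^-1` B =
      \bigcup_(v in range (s n) `&` [set v | B `|v|]) s n @^-1` [set v].
    apply/seteqP; split=> [x /= Bx|x /= [v [_ Bv] /= ->]//].
    by exists (s n x) => //; split=> //; exists x.
  by apply: fin_bigcup_measurable => // ; exact: finite_setIl.
exact: cvg_norm.
Qed.

Lemma strongly_measurable_norm_powR (H : normedModType R) (p : R) (f : T -> H) :
  strongly_measurable measurable f ->
  measurable_fun setT (fun x => `|f x| `^ p).
Proof.
move=> /strongly_measurable_norm mf.
exact: (measurableT_comp (measurable_powR p)).
Qed.

End integral.

(** * The expected regret *)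

Theorem corollary5p4 (R : realType)
  (H : completeNormedModType R) (dot : {dot H for idfun})
  (dotE : forall x : H, dot x x = `|x| ^+ 2)
  (W : set H) (W0 : W !=set0) (Wclosed : closed W)
  (Wconvex : convex_set (W : set (convex_lmodType H)))
  (D : R) (WD : diameter W = D%:E)
  (p : R) (p1 : 1 < p) (p2 : p <= 2)
  (d : measure_display) (Omega : measurableType d) (P : probability Omega R)
  (F : nat -> set (set Omega)) (Ffilt : filtration F)
  (g : nat -> Omega -> H)
  (g_adapted : forall t, (1 <= t)%N -> strongly_measurable (F t) (g t))
  (g_Lp : forall t, (1 <= t)%N -> bochner_Lp P p (g t))
  (eta tau : R) (eta0 : 0 < eta) (tau0 : 0 < tau)
  (M : nat -> Omega -> R)
  (M_cond : forall t, (1 <= t)%N ->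
    is_cond_expectation P (F t.-1) (fun omega => `|g t omega| `^ p) (M t))
  (T : nat) (T1 : (1 <= T)%N) (u : H) (uW : W u) :
  let Y := fun t omega => clip tau (g t omega) in
  let w := fun t omega => ftrl dot W eta (fun s => Y s omega) t in
  let regret := fun omega =>
    \sum_(1 <= t < T.+1) dot (g t omega) (w t omega - u) in
  ('E_P[regret] <=
   (`|u| ^+ 2 / (2 * eta))%:E +
   \sum_(1 <= t < T.+1)
     'E_P[fun omega => (K_ p D (eta * tau / 2) * tau `^ (1 - p) * M t omega)%R])%E.
Proof.
cbv zeta.
set kappa := K_ p D (eta * tau / 2) * tau `^ (1 - p).
have kappa0 : 0 <= kappa.
  have beta0 : 0 <= eta * tau / 2 by rewrite divr_ge0 ?mulr_ge0 ?ltW.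
  by rewrite mulr_ge0 ?powR_ge0// (le_trans beta0)// K_ge.
(* The defining property of the conditional expectation, on the whole space. *)
have M_mean t : (1 <= t)%N ->
    ('E_P[fun omega => (kappa * M t omega)%R] =
     \int[P]_omega (kappa * `|g t omega| `^ p)%:E)%E.
  move=> t1; have [_ intM /(_ setT) meanM] := M_cond _ t1.
  have FT : F t.-1 setT.
    have [/(_ t.-1) [F0 FC _] _ _] := Ffilt.
    by rewrite -(setD0 setT); exact: FC.
  have mg : measurable_fun setT (fun omega => (`|g t omega| `^ p)%:E).
    apply/measurable_EFinP/strongly_measurable_norm_powR.
    by have [] := g_Lp _ t1.
  rewrite unlock.
  under eq_integral do rewrite EFinM.
  under [in RHS]eq_integral do rewrite EFinM.
  rewrite integralZl// meanM// ge0_integralZl//.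
rewrite [in leLHS]unlock.
apply: (@le_trans _ _ (\int[P]_omega ((`|u| ^+ 2 / (2 * eta))%:E +
    \sum_(1 <= t < T.+1) (kappa * `|g t omega| `^ p)%:E))%E).
  apply: le_integral_nonmeasurable => omega.
  rewrite sumEFin -EFinD lee_fin.
  exact: clipped_ftrl_regret.
(* Shift the index, so that the hypotheses on g hold for every term. *)
rewrite !big_add1 /=; under eq_integral do rewrite big_add1.
have mg t : measurable_fun setT (fun omega => (kappa * `|g t.+1 omega| `^ p)%:E).
  apply/measurable_EFinP; apply: measurable_funM => //.
  by apply: strongly_measurable_norm_powR; have [] := g_Lp _ (ltn0Sn t).
have g0 t omega : (0 <= (kappa * `|g t.+1 omega| `^ p)%:E)%E.
  by rewrite lee_fin mulr_ge0 ?powR_ge0.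
rewrite ge0_integralD//; last 3 first.
- by move=> omega _; rewrite lee_fin divr_ge0 ?sqr_ge0// mulr_ge0// ltW.
- by move=> omega _; apply: sume_ge0 => t _; exact: g0.
- exact: emeasurable_sum.
rewrite integral_cst//= probability_setT mule1 ge0_integral_sum//.
by under [in leRHS]eq_bigr do rewrite M_mean//.
Qed.
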